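(* Let $\Sigma$ be a signature and $\equiv$ an operad congruence of $T(\Sigma)$ which is compatible with the degree and of finite type. Then the linear map $\phi:\mathbf N(T(\Sigma)/_\equiv)\to\mathbf N(T(\Sigma))$ defined, for every reduced word $x$ on $T(\Sigma)/_\equiv$, by $$\phi(E_x)=\sum_{f\text{ reduced }\Sigma\text{-forest}}[\pi_\equiv(f)=x]\;E_f$$ is a well-defined injective Hopf algebra morphism.
   Context: $\mathbb K$ is a field of characteristic zero; $[P]$ is $1$ if $P$ holds and $0$ otherwise. A signature is a set $\Sigma$ with an arity map $|\cdot|:\Sigma\to\mathbb N$; $\Sigma(n)$ is the set of elements of arity $n$. A $\Sigma$-term is either the leaf $\bot$ or $s(t_1,\dots,t_n)$ with $s\in\Sigma(n)$ and $\Sigma$-terms $t_i$; its degree is the number of internal nodes, its arity $|t|$ the number of leaves. $T(\Sigma)$ is the free nonsymmetric operad on $\Sigma$ (composition $t[t_1,\dots,t_{|t|}]$ grafts $t_i$ onto the $i$-th leaf of $t$, partial composition $\circ_i$ grafts onto the $i$-th leaf, unit $\bot$). A $\Sigma$-forest is a finite word of terms; it is reduced if no term is $\bot$. An operad congruence of $T(\Sigma)$ is an equivalence relation $\equiv$ such that $t\equiv t'$ implies $|t|=|t'|$, $t\circ_i s\equiv t'\circ_i s$ and $s\circ_j t\equiv s\circ_j t'$ for all $s$ and valid $i,j$. It is compatible with the degree if $t\equiv t'$ implies $\deg t=\deg t'$, and of finite type if all classes are finite. $\pi_\equiv:T(\Sigma)\to T(\Sigma)/_\equiv$ is the canonical projection,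 extended letterwise to words: $\pi_\equiv(t_1\cdots t_k)=\pi_\equiv(t_1)\cdots\pi_\equiv(t_k)$. Natural Hopf algebra: for a nonsymmetric operad $\mathcal O$ with unit $1$ which is finitely factorizable (each $x$ has finitely many factorizations $x=y[y'_1,\dots,y'_{|y|}]$) and has a grading $\deg$ ($\deg^{-1}(0)=\{1\}$, additive under composition), $\mathbf N(\mathcal O)$ is the vector space with basis $E_w$ indexed by words $w$ on $\mathcal O\setminus\{1\}$ (reduced words), with product $E_{w_1}E_{w_2}=E_{w_1w_2}$ and coproduct the unique algebra morphism with $\Delta E_x=\sum_{y\in\mathcal O}\sum_{(y'_1,\dots,y'_{|y|})}[x=y[y'_1,\dots,y'_{|y|}]]\,E_{\mathrm{rd}(y)}\otimes E_{\mathrm{rd}(y'_1\cdots y'_{|y|})}$ for $x\in\mathcal O$, where $\mathrm{rd}$ deletes the letters equal to $1$ from a word; it is a graded Hopf algebra. Under the hypotheses, $T(\Sigma)/_\equiv$ is finitely factorizable and graded by the degree of representatives, so $\mathbf N(T(\Sigma)/_\equiv)$ is defined; $\mathbf N(T(\Sigma))$ has basis $E_f$ indexed by reduced $\Sigma$-forests. *)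

(* Defs.v *)
From mathcomp Require Import all_boot all_order all_algebra.
From Stdlib Require Import ClassicalEpsilon.
Set Implicit Arguments. Unset Strict Implicit. Unset Printing Implicit Defensive.
Import GRing.Theory.
Local Open Scope ring_scope.

Section Classical.
Variable K : fieldType.

Definition iverson (P : Prop) : K :=
  if excluded_middle_informative P then 1 else 0.

(* sum of F over the finite set {a | P a}; 0 (junk) if that set is infinite *)
Definition fsum (A : Type) (P : A -> Prop) (F : A -> K) : K :=
  match excluded_middle_informative
          (exists s : seq A, List.NoDup s /\ forall a, P a <-> List.In a s) with
  | left H => \sum_(a <- proj1_sig (constructive_indefinite_description _ H)) F a
  | right _ => 0
  end.

Definition finsupp (A : Type) (c : A -> K) : Prop :=
  exists s : seq A, forall a, c a <> 0 -> List.In a s.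
End Classical.

(* The natural Hopf algebra N(O) of a nonsymmetric operad O, given by its    *)
(* carrier O, unit, arity and (full) composition comp y [y'_1;..;y'_|y|].     *)
(* Elements of N(O) are coefficient functions on words on O (coefficient of  *)
(* E_w at w); elements of N(O) (x) N(O) are coefficient functions on pairs   *)
(* of words.                                                                 *)
Section Natural.
Variable K : fieldType.
Variables (O : Type) (unit : O) (arity : O -> nat) (comp : O -> seq O -> O).

Definition reduced (w : seq O) : Prop := forall y, List.In y w -> y <> unit.

Definition rd (w : seq O) : seq O :=
  filter (fun y => if excluded_middle_informative (y = unit) then false else true) w.

Definition Nvec := seq O -> K.
Definition Ntens := seq O -> seq O -> K.

Definition isN (c : Nvec) : Prop :=
  finsupp c /\ forall w, c w <> 0 -> reduced w.

Definition Ebasis (w : seq O) : Nvec := fun w' => iverson K (w' = w).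

(* product E_w1 E_w2 = E_(w1 w2), bilinearly extended *)
Definition Nmul (c1 c2 : Nvec) : Nvec := fun w =>
  \sum_(i < (size w).+1) c1 (take i w) * c2 (drop i w).
Definition Nunit : Nvec := fun w => if nilp w then 1 else 0.

Definition Ncounit (c : Nvec) : K := c [::].

Definition Tmul (A B : Ntens) : Ntens := fun u v =>
  \sum_(i < (size u).+1) \sum_(j < (size v).+1)
     A (take i u) (take j v) * B (drop i u) (drop j v).
Definition Tone : Ntens := fun u v => if nilp u && nilp v then 1 else 0.

(* Delta E_x for a letter x: coefficient of E_u (x) E_v is the number of     *)
(* factorizations x = y[y'_1,..,y'_|y|] with rd(y) = u and rd(y'..) = v      *)
Definition Dletter (x : O) : Ntens := fun u v =>
  fsum (fun p : O * seq O =>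
            [/\ size p.2 = arity p.1, x = comp p.1 p.2,
                rd [:: p.1] = u & rd p.2 = v])
       (fun _ => 1).

(* Delta extended as an algebra morphism to words *)
Definition Dword (w : seq O) : Ntens := foldr (fun x acc => Tmul (Dletter x) acc) Tone w.

Definition Ncoprod (c : Nvec) : Ntens := fun u v =>
  fsum (fun w => c w <> 0) (fun w => c w * Dword w u v).
End Natural.

Section Terms.
Variables (Sig : Type) (ar : Sig -> nat).

Inductive term : Type := Leaf | Node of Sig & seq term.

Fixpoint wfb (t : term) : bool :=
  match t with
  | Leaf => true
  | Node s ts => (size ts == ar s) && all wfb ts
  end.

Fixpoint nleaves (t : term) : nat :=
  match t with
  | Leaf => 1
  | Node _ ts => sumn (map nleaves ts)
  end.

Fixpoint nnodes (t : term) : nat :=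
  match t with
  | Leaf => 0
  | Node _ ts => (sumn (map nnodes ts)).+1
  end.

Fixpoint graft_aux (t : term) (ts : seq term) {struct t} : term * seq term :=
  match t with
  | Leaf => match ts with [::] => (Leaf, [::]) | u :: r => (u, r) end
  | Node s cs =>
      let res := (fix go (cs : seq term) (ts : seq term) : seq term * seq term :=
                    match cs with
                    | [::] => ([::], ts)
                    | c :: cs' => let r1 := graft_aux c ts in
                                  let r2 := go cs' r1.2 in (r1.1 :: r2.1, r2.2)
                    end) cs ts in
      (Node s res.1, res.2)
  end.
Definition graft (t : term) (ts : seq term) : term := (graft_aux t ts).1.

Definition wterm := {t : term | wfb t}.
Definition wunit : wterm := exist _ Leaf (erefl true).
Definition warity (t : wterm) : nat := nleaves (proj1_sig t).
Definition wdeg (t : wterm) : nat := nnodes (proj1_sig t).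

(* composition t[t_1, ..., t_|t|] (junk value t if the result is ill-formed,
   which never happens when size ts = warity t) *)
Definition wcomp (t : wterm) (ts : seq wterm) : wterm :=
  let g := graft (proj1_sig t) (map (@proj1_sig _ _) ts) in
  match wfb g as b return wfb g = b -> wterm with
  | true => fun H => exist _ g H
  | false => fun _ => t
  end (erefl _).

(* partial composition t o_i s, i 0-based (i < warity t) *)
Definition wpcomp (t : wterm) (i : nat) (s : wterm) : wterm :=
  wcomp t (mkseq (fun j => if j == i then s else wunit) (warity t)).

Definition operad_congruence (R : wterm -> wterm -> Prop) : Prop :=
  (forall t, R t t) /\ (forall t u, R t u -> R u t) /\
  (forall t u v, R t u -> R u v -> R t v) /\
  (forall t t', R t t' -> warity t = warity t') /\
  (forall t t' s i, R t t' -> (i < warity t)%N -> R (wpcomp t i s) (wpcomp t' i s)) /\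
  (forall t t' s j, R t t' -> (j < warity s)%N -> R (wpcomp s j t) (wpcomp s j t')).

Definition degree_compatible (R : wterm -> wterm -> Prop) : Prop :=
  forall t t', R t t' -> wdeg t = wdeg t'.

Definition finite_type (R : wterm -> wterm -> Prop) : Prop :=
  forall t, exists s : seq wterm, forall u, R t u -> List.In u s.

Section Quotient.
Variable R : wterm -> wterm -> Prop.

Definition qterm := {C : wterm -> Prop | exists t, C = R t}.
Definition qproj (t : wterm) : qterm := exist _ (R t) (ex_intro _ t erefl).
Definition qrep (C : qterm) : wterm :=
  proj1_sig (constructive_indefinite_description _ (proj2_sig C)).
Definition qunit : qterm := qproj wunit.
Definition qarity (C : qterm) : nat := warity (qrep C).
Definition qcomp (C : qterm) (Cs : seq qterm) : qterm :=
  qproj (wcomp (qrep C) (map qrep Cs)).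

Definition qproj_word (f : seq wterm) : seq qterm := map qproj f.

Section Phi.
Variable K : fieldType.
Definition phiE (x : seq qterm) : Nvec K wterm := fun f =>
  iverson K (reduced wunit f /\ qproj_word f = x).
Definition phi (c : Nvec K qterm) : Nvec K wterm := fun f =>
  fsum (fun x => c x <> 0) (fun x => c x * phiE x f).
Definition phi2 (D : Ntens K qterm) : Ntens K wterm := fun f1 f2 =>
  fsum (fun p : seq qterm * seq qterm => D p.1 p.2 <> 0)
       (fun p => D p.1 p.2 * phiE p.1 f1 * phiE p.2 f2).
End Phi.
End Quotient.
End Terms.

(* Main.v *)
Require Import Defs.
From mathcomp Require Import all_boot all_order all_algebra.
From Stdlib Require Import ClassicalEpsilon FunctionalExtensionality.
From Stdlib Require Import PropExtensionality ProofIrrelevance.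
From Stdlib Require List Permutation.
Set Implicit Arguments. Unset Strict Implicit. Unset Printing Implicit Defensive.
Import GRing.Theory.
Local Open Scope ring_scope.

(** A letter equal to the unit lifts only to the leaf, by compatibility with the
    degree. Hence, for reduced forests [u] and [v], projecting a factorization
    is a bijection from the pairs [(y, y')] of terms with [rd y = u], [rd y' = v]
    and [pi (y[y']) = X] onto the factorizations of [X] in the quotient with
    reductions [pi u] and [pi v]. So the coefficient of [E_(pi u) (x) E_(pi v)]
    in the coproduct of [E_X] is the sum over [t] in [X] of the coefficients of
    [E_u (x) E_v] in the coproducts of the [E_t], and this passes to words by
    multiplicativity. On [N(T/R)], [phi c] is [c] composed with [pi], which makes
    the remaining claims immediate. *)

(** * Finite predicates and their duplicate-free enumerations *)

Section FiniteSets.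

(** Only a covering list is asked for, possibly with repetitions and extra elements, which makes
    finiteness easy to transport. Applied to a support, this unfolds to [finsupp]. *)
Definition finite_pred (A : Type) (P : A -> Prop) : Prop :=
  exists s : seq A, forall a, P a -> List.In a s.

(** This is the exact condition on a list that [fsum] tests for. *)
Definition enumerates (A : Type) (P : A -> Prop) (s : seq A) : Prop :=
  List.NoDup s /\ forall a, P a <-> List.In a s.

Definition classical_eq_dec (A : Type) (x y : A) : {x = y} + {x <> y} :=
  excluded_middle_informative (x = y).

Lemma finite_predS (A : Type) (P Q : A -> Prop) :
  (forall a, P a -> Q a) -> finite_pred Q -> finite_pred P.
Proof. by move=> PQ [s sP]; exists s => a /PQ/sP. Qed.

Lemma finite_pred_enumerates (A : Type) (P : A -> Prop) :
  finite_pred P -> exists s, enumerates P s.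
Proof.
move=> [s sP].
exists (List.filter (fun a => if excluded_middle_informative (P a) then true else false)
  (List.nodup (@classical_eq_dec A) s)); split.
  by apply: List.NoDup_filter; apply: List.NoDup_nodup.
move=> a; rewrite List.filter_In List.nodup_In.
case: excluded_middle_informative => Pa; split=> //; last by case.
by split=> //; apply: sP.
Qed.

Lemma finite_pred_union (A B : Type) (s : seq B) (P : B -> A -> Prop) :
  (forall b, List.In b s -> finite_pred (P b)) ->
  finite_pred (fun a => exists2 b, List.In b s & P b a).
Proof.
elim: s => [|b s IH] finP; first by exists [::] => a [].
have [l lP] := finP b (or_introl erefl).
have [l' l'P] := IH (fun b' b's => finP b' (or_intror b's)).
exists (l ++ l') => a [b' b's Pb'a]; apply: List.in_or_app.
by case: b's Pb'a => [<- /lP|b's Pb'a]; [left|right; apply: l'P; exists b'].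
Qed.

(** [P] is the union of its fibres under [f] over an enumeration of [Q]. *)
Lemma finite_pred_fiber (A B : Type) (f : A -> B) (P : A -> Prop) (Q : B -> Prop) :
  finite_pred Q -> (forall a, P a -> Q (f a)) ->
  (forall b, Q b -> finite_pred (fun a => P a /\ f a = b)) -> finite_pred P.
Proof.
move=> /finite_pred_enumerates[s [_ sQ]] PQ fib.
have := @finite_pred_union A B s (fun b a => P a /\ f a = b).
case=> [b /sQ/fib//|l lP]; exists l => a Pa; apply: lP.
by exists (f a) => //; apply/sQ/PQ.
Qed.

Lemma finite_pred_inj (A B : Type) (f : A -> B) (P : A -> Prop) (Q : B -> Prop) :
  finite_pred Q -> (forall a, P a -> Q (f a)) ->
  (forall a a', P a -> P a' -> f a = f a' -> a = a') -> finite_pred P.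
Proof.
move=> finQ PQ inj; apply: finite_pred_fiber finQ PQ _ => b _.
have [[a [Pa fa]]|nfib] := excluded_middle_informative (exists a, P a /\ f a = b).
  by exists [:: a] => a' [Pa' fa']; left; apply: inj; rewrite ?fa.
by exists [::] => a' Pa'; case: nfib; exists a'.
Qed.

(** It suffices that the image of [Q] under [g] covers [P]; it may be larger. Supports are bounded
    in this way. *)
Lemma finite_pred_surj (A B : Type) (g : B -> A) (P : A -> Prop) (Q : B -> Prop) :
  finite_pred Q -> (forall a, P a -> exists2 b, Q b & a = g b) -> finite_pred P.
Proof.
move=> [s sQ] PQ; exists (map g s) => a /PQ[b /sQ bs ->].
exact: List.in_map.
Qed.

Lemma finite_pred_prod (A B : Type) (P : A -> Prop) (Q : B -> Prop) :
  finite_pred P -> finite_pred Q ->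
  finite_pred (fun p : A * B => P p.1 /\ Q p.2).
Proof.
move=> [s sP] [l lQ]; exists (List.list_prod s l) => -[a b] /= [Pa Qb].
by apply: List.in_prod; [apply: sP|apply: lQ].
Qed.

Lemma In_flatten (A B : Type) (g : B -> seq A) (s : seq B) (a : A) :
  List.In a (flatten (map g s)) <-> exists2 b, List.In b s & List.In a (g b).
Proof.
elim: s => [|b s IH] /=; first by split=> // -[].
split=> [H|[b' [->|b's] ab']].
- case: (List.in_app_or _ _ _ H) => [ab|/IH[b' b's ab']].
    by exists b; [left|].
  by exists b'; [right|].
- by apply: List.in_or_app; left.
- by apply: List.in_or_app; right; apply/IH; exists b'.
Qed.

Lemma NoDup_flatten (A B : Type) (g : B -> seq A) (s : seq B) :
  List.NoDup s -> (forall b, List.NoDup (g b)) ->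
  (forall b b' a, List.In a (g b) -> List.In a (g b') -> b = b') ->
  List.NoDup (flatten (map g s)).
Proof.
move=> ss gs disj; elim: s ss => [|b l IH] /=; first by move=> _; apply: List.NoDup_nil.
move=> /List.NoDup_cons_iff[bl /IH nl]; apply: List.NoDup_app => // a ab.
move=> /In_flatten[b' b'l ab'].
by apply: bl; rewrite (disj _ _ _ ab ab').
Qed.

End FiniteSets.

(** * Sums over finite predicates: reindexing, fibres, supports *)

Section FiniteSums.
Variable K : fieldType.

Lemma iversonT (P : Prop) : P -> iverson K P = 1.
Proof. by rewrite /iverson; case: excluded_middle_informative. Qed.

Lemma iversonF (P : Prop) : ~ P -> iverson K P = 0.
Proof. by rewrite /iverson; case: excluded_middle_informative. Qed.

(** The case distinction copies that of [fsum]. The empty list for infinite predicates matches the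
    default value 0, so [fsumE] holds without any finiteness assumption. *)
Definition enum_pred (A : Type) (P : A -> Prop) : seq A :=
  match excluded_middle_informative
          (exists s : seq A, List.NoDup s /\ forall a, P a <-> List.In a s) with
  | left H => proj1_sig (constructive_indefinite_description _ H)
  | right _ => [::]
  end.

Lemma enum_predP (A : Type) (P : A -> Prop) :
  finite_pred P -> enumerates P (enum_pred P).
Proof.
move=> /finite_pred_enumerates exP; rewrite /enum_pred.
case: excluded_middle_informative => // H.
exact: (proj2_sig (constructive_indefinite_description _ H)).
Qed.

Lemma enum_pred_NoDup (A : Type) (P : A -> Prop) : List.NoDup (enum_pred P).
Proof.
rewrite /enum_pred; case: excluded_middle_informative => [H|_].
  by case: (proj2_sig (constructive_indefinite_description _ H)).
exact: List.NoDup_nil.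
Qed.

Lemma In_enum_pred (A : Type) (P : A -> Prop) a : List.In a (enum_pred P) -> P a.
Proof.
rewrite /enum_pred; case: excluded_middle_informative => // H.
by case: (proj2_sig (constructive_indefinite_description _ H)) => _ sP /sP.
Qed.

Lemma fsumE (A : Type) (P : A -> Prop) (F : A -> K) :
  fsum P F = \sum_(a <- enum_pred P) F a.
Proof.
by rewrite /fsum /enum_pred; case: excluded_middle_informative => // _; rewrite big_nil.
Qed.

Lemma eq_big_In (A : Type) (s : seq A) (F G : A -> K) :
  (forall a, List.In a s -> F a = G a) -> \sum_(a <- s) F a = \sum_(a <- s) G a.
Proof.
elim: s => [|a s IH] FG; first by rewrite !big_nil.
rewrite !big_cons FG; last by left.
by rewrite IH // => b bs; apply: FG; right.
Qed.

(** The index type has no decidable equality, so the inductive [Permutation] is used. *)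
Lemma big_Permutation (A : Type) (s l : seq A) (F : A -> K) :
  Permutation.Permutation s l -> \sum_(a <- s) F a = \sum_(a <- l) F a.
Proof.
elim=> [|a s' l' _ IH|a b s'|s1 s2 s3 _ IH1 _ IH2] //.
- by rewrite !big_cons IH.
- by rewrite !big_cons addrCA.
- by rewrite IH1.
Qed.

(** Two enumerations of [P] are permutations of each other, so the list chosen inside [fsum] does
    not matter. *)
Lemma fsum_enumerates (A : Type) (P : A -> Prop) (s : seq A) (F : A -> K) :
  enumerates P s -> fsum P F = \sum_(a <- s) F a.
Proof.
move=> [ss sP]; have [ees eP] : enumerates P (enum_pred P).
  by apply: enum_predP; exists s => a /sP.
rewrite fsumE; apply/big_Permutation/Permutation.NoDup_Permutation => // a.
by rewrite -sP -eP.
Qed.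

Lemma eq_fsum (A : Type) (P P' : A -> Prop) (F F' : A -> K) :
  (forall a, P a <-> P' a) -> (forall a, P a -> F a = F' a) -> fsum P F = fsum P' F'.
Proof.
move=> PP' FF'.
have <- : P = P'.
  by apply: functional_extensionality => a; apply: propositional_extensionality.
by rewrite !fsumE; apply: eq_big_In => a aP; apply: FF'; apply: In_enum_pred aP.
Qed.

(** Concatenating enumerations of the fibres of [g] enumerates [P]: distinct fibres are disjoint, so
    no element is repeated. *)
Lemma fsum_fiber (A B : Type) (g : A -> B) (P : A -> Prop) (Q : B -> Prop) (F : A -> K) :
  finite_pred P -> finite_pred Q -> (forall a, P a -> Q (g a)) ->
  fsum P F = fsum Q (fun b => fsum (fun a => P a /\ g a = b) F).
Proof.
move=> finP finQ PQ.
have [_ eQ] := enum_predP finQ.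
have eP b : enumerates (fun a => P a /\ g a = b) (enum_pred (fun a => P a /\ g a = b)).
  by apply: enum_predP; apply: finite_predS finP => a [].
rewrite [RHS]fsumE; under eq_bigr do rewrite fsumE.
rewrite -(big_map (fun b => enum_pred (fun a => P a /\ g a = b)) xpredT
  (fun l => \sum_(a <- l) F a)) -big_flatten.
apply: fsum_enumerates; split.
  apply: NoDup_flatten; first exact: enum_pred_NoDup.
    by move=> b; exact: enum_pred_NoDup.
  by move=> b b' a ab ab'; case: (In_enum_pred ab) (In_enum_pred ab') => _ <- [_ <-].
move=> a; rewrite In_flatten; split=> [Pa|[b _ ab]]; last by case: (In_enum_pred ab).
by exists (g a); [apply/eQ/PQ|apply/(proj2 (eP _))].
Qed.

Lemma fsum_bij (A B : Type) (g : A -> B) (P : A -> Prop) (Q : B -> Prop) (F : B -> K) :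
  finite_pred P -> (forall a, P a -> Q (g a)) ->
  (forall a a', P a -> P a' -> g a = g a' -> a = a') ->
  (forall b, Q b -> exists2 a, P a & g a = b) ->
  fsum Q F = fsum P (fun a => F (g a)).
Proof.
move=> finP PQ inj surj; have [ss sP] := enum_predP finP.
rewrite [RHS]fsumE -(big_map g xpredT F).
apply: fsum_enumerates; split.
  apply: List.NoDup_map_NoDup_ForallPairs => // a a' /sP Pa /sP Pa'.
  exact: inj.
move=> b; split=> [/surj[a /sP Pa <-]|]; first exact: List.in_map.
by move=> /List.in_map_iff[a [<- /sP Pa]]; apply: PQ.
Qed.

Lemma fsum_supp (A : Type) (P : A -> Prop) (s : seq A) (F : A -> K) :
  List.NoDup s -> (forall a, P a -> List.In a s) -> (forall a, ~ P a -> F a = 0) ->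
  fsum P F = \sum_(a <- s) F a.
Proof.
move=> ss Ps F0.
pose p a := if excluded_middle_informative (P a) then true else false.
rewrite (@fsum_enumerates _ _ (filter p s)).
  rewrite big_filter big_mkcond; apply: eq_bigr => a _; rewrite /p.
  by case: excluded_middle_informative => // nPa; rewrite F0.
split; first exact: List.NoDup_filter.
move=> a; rewrite -[filter p s]/(List.filter p s) List.filter_In /p.
case: excluded_middle_informative => Pa; split=> //; last by case.
by split=> //; apply: Ps.
Qed.

(** The point [b] may lie outside [P]; then both sides are 0. *)
Lemma fsum_single (A : Type) (P : A -> Prop) (F : A -> K) b :
  finite_pred P -> (forall a, ~ P a -> F a = 0) -> (forall a, a <> b -> F a = 0) ->
  fsum P F = F b.
Proof.
move=> finP F0 Fb.
have -> : fsum P F = fsum (fun a => a = b /\ P a) F.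
  have [ss sP] := enum_predP finP.
  rewrite [LHS]fsumE; symmetry; apply: fsum_supp => // [a [_ /sP]//|a nPa].
  have [ab|/Fb//] := excluded_middle_informative (a = b).
  by apply: F0 => Pa; apply: nPa.
have [Pb|nPb] := excluded_middle_informative (P b).
  rewrite (@fsum_enumerates _ _ [:: b]) ?big_seq1 //; split.
    by apply: List.NoDup_cons => //; exact: List.NoDup_nil.
  by move=> a /=; split=> [[-> _]|[<-|]//]; left.
rewrite (@fsum_enumerates _ _ [::]) ?big_nil ?F0 //; split.
  exact: List.NoDup_nil.
by move=> a; split=> // -[-> /nPb].
Qed.

Lemma fsum_distrr (A : Type) (P : A -> Prop) (F : A -> K) (k : K) :
  fsum P (fun a => k * F a) = k * fsum P F.
Proof. by rewrite !fsumE big_distrr. Qed.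

Lemma fsum_neq0 (A : Type) (P : A -> Prop) (F : A -> K) :
  fsum P F <> 0 -> exists2 a, P a & F a <> 0.
Proof.
rewrite fsumE => nz; apply: NNPP => nex; apply: nz.
rewrite (@eq_big_In _ _ _ (fun=> 0)) ?big1 // => a aP.
by apply: NNPP => Fa; apply: nex; exists a => //; apply: In_enum_pred aP.
Qed.

End FiniteSums.

Lemma split_size (A : Type) (m n : nat) (s : seq A) :
  size s = (m + n)%N -> exists a b, [/\ s = a ++ b, size a = m & size b = n].
Proof.
move=> ss; exists (take m s), (drop m s).
by rewrite cat_take_drop size_takel ?size_drop ss ?leq_addr // addKn.
Qed.

(** * Grafting of raw terms: associativity and finiteness of factorizations *)

Section Grafting.
Variables (Sig : Type) (ar : Sig -> nat).
Implicit Types (t c x : term Sig) (ts us cs a b : seq (term Sig)).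

(** Terms are nested through [seq], so the induction hypothesis has to cover every child in the
    list. *)
Lemma term_nested_ind (P : term Sig -> Prop) :
  P (Leaf Sig) -> (forall s ts, (forall t, List.In t ts -> P t) -> P (Node s ts)) ->
  forall t, P t.
Proof.
move=> PL PN; fix IH 1; case=> [|s ts]; first exact: PL.
apply: PN; elim: ts => [|t ts IHts] u; first by case.
by case=> [<-|]; [apply: IH|apply: IHts].
Qed.

(** A named copy, equal by conversion, of the local fixpoint inside [graft_aux]. *)
Fixpoint grafts_aux (cs ts : seq (term Sig)) : seq (term Sig) * seq (term Sig) :=
  match cs with
  | [::] => ([::], ts)
  | c :: cs' => let r1 := graft_aux c ts in
                let r2 := grafts_aux cs' r1.2 in (r1.1 :: r2.1, r2.2)
  end.

(* The terms of [cs] grafted with consecutive chunks of [ts]. *)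
Definition grafts (cs ts : seq (term Sig)) := (grafts_aux cs ts).1.

Definition nleavess (cs : seq (term Sig)) : nat := sumn (map (@nleaves Sig) cs).

Lemma graft_aux_Node (s : Sig) cs ts :
  graft_aux (Node s cs) ts = (Node s (grafts_aux cs ts).1, (grafts_aux cs ts).2).
Proof. by []. Qed.

Lemma graft_Node (s : Sig) cs ts : graft (Node s cs) ts = Node s (grafts cs ts).
Proof. by []. Qed.

Lemma graft_Leaf t : graft (Leaf Sig) [:: t] = t.
Proof. by []. Qed.

(** Grafting consumes exactly one term per leaf and hands back the rest. This removes the threaded
    state: later inductions cut the list child by child. *)
Lemma graft_aux_cat t a b :
  size a = nleaves t -> graft_aux t (a ++ b) = (graft t a, b).
Proof.
elim/term_nested_ind: t a b => [|s cs IH] a b; first by case: a => [|x []].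
rewrite graft_Node graft_aux_Node /= -/(nleavess cs) => sa.
suff -> : grafts_aux cs (a ++ b) = (grafts cs a, b) by [].
elim: cs IH a sa => [|c cs IHcs] IH a; first by case: a.
rewrite /nleavess /= => /split_size[a1 [a2 [-> s1 s2]]].
rewrite /grafts /= -catA !IH //=; try by left.
by rewrite (IHcs _ _ s2) // => t tcs; apply: IH; right.
Qed.

Lemma grafts_cons c cs a b :
  size a = nleaves c -> grafts (c :: cs) (a ++ b) = graft c a :: grafts cs b.
Proof. by move=> sa; rewrite /grafts /= graft_aux_cat. Qed.

Lemma nleavess_cons c cs : nleavess (c :: cs) = (nleaves c + nleavess cs)%N.
Proof. by []. Qed.

Lemma nleavess_cat cs cs' : nleavess (cs ++ cs') = (nleavess cs + nleavess cs')%N.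
Proof. by rewrite /nleavess map_cat sumn_cat. Qed.

Lemma grafts_cat cs cs' a b :
  size a = nleavess cs -> grafts (cs ++ cs') (a ++ b) = grafts cs a ++ grafts cs' b.
Proof.
elim: cs a => [|c cs IH] a; first by case: a.
rewrite nleavess_cons => /split_size[a1 [a2 [-> s1 s2]]].
by rewrite -catA cat_cons grafts_cons // grafts_cons // IH.
Qed.

Lemma size_grafts cs ts : size (grafts cs ts) = size cs.
Proof. by elim: cs ts => //= c cs IH ts; rewrite /grafts /= IH. Qed.

Lemma nleaves_graft t ts : size ts = nleaves t -> nleaves (graft t ts) = nleavess ts.
Proof.
elim/term_nested_ind: t ts => [|s cs IH] ts.
  by case: ts => [|x []] // _; rewrite graft_Leaf nleavess_cons addn0.
rewrite graft_Node /= -/(nleavess cs) -/(nleavess (grafts cs ts)).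
elim: cs IH ts => [|c cs IHcs] IH ts; first by case: ts.
rewrite nleavess_cons => /split_size[a [b [-> sa sb]]].
rewrite grafts_cons // nleavess_cat nleavess_cons IH ?IHcs //; last by left.
by move=> t tcs; apply: IH; right.
Qed.

Lemma wfb_graft t ts :
  size ts = nleaves t -> wfb ar t -> all (wfb ar) ts -> wfb ar (graft t ts).
Proof.
elim/term_nested_ind: t ts => [|s cs IH] ts.
  by case: ts => [|x []] //= _ _; rewrite andbT graft_Leaf.
rewrite graft_Node /= -/(nleavess cs) size_grafts => sts /andP[-> /=].
elim: cs IH ts sts => [|c cs IHcs] IH ts //.
rewrite nleavess_cons => /split_size[a [b [-> sa sb]]].
rewrite all_cat grafts_cons //= => /andP[wc wcs] /andP[wa wb].
rewrite IH ?IHcs //; last by left.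
by move=> t tcs; apply: IH; right.
Qed.

Lemma graft_units t : graft t (nseq (nleaves t) (Leaf Sig)) = t.
Proof.
elim/term_nested_ind: t => [|s cs IH] //.
rewrite graft_Node /= -/(nleavess cs); congr Node.
elim: cs IH => [|c cs IHcs] IH //.
rewrite nleavess_cons nseqD grafts_cons ?size_nseq // IH ?IHcs //; last by left.
by move=> t tcs; apply: IH; right.
Qed.

Lemma grafts_units ts : grafts ts (nseq (nleavess ts) (Leaf Sig)) = ts.
Proof.
elim: ts => [|t ts IH] //.
by rewrite nleavess_cons nseqD grafts_cons ?size_nseq // graft_units IH.
Qed.

(** Associativity of the free operad. Below a node, [ts] is cut by the leaves of each child, and
    [us] by the leaves of each resulting piece of [ts]. *)
Lemma graftA t ts us :
  size ts = nleaves t -> size us = nleavess ts ->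
  graft (graft t ts) us = graft t (grafts ts us).
Proof.
elim/term_nested_ind: t ts us => [|s cs IH] ts us.
  by case: ts => [|x []].
rewrite !graft_Node /= -/(nleavess cs) => sts sus; congr Node.
elim: cs IH ts us sts sus => [|c cs IHcs] IH ts us; first by case: ts.
rewrite nleavess_cons => /split_size[a [b [-> sa sb]]].
rewrite nleavess_cat => /split_size[u [v [-> su sv]]].
rewrite grafts_cons // grafts_cons ?nleaves_graft // grafts_cat //.
rewrite grafts_cons ?size_grafts // IH ?IHcs //; last by left.
by move=> t tcs; apply: IH; right.
Qed.

(** By associativity, one factor can be postponed: a leaf holds its place and [s] is grafted there
    afterwards. Congruences are given on partial compositions only, and this lets them reach full
    ones. *)
Lemma graft_insert t a s b :
  size (a ++ s :: b) = nleaves t ->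
  graft t (a ++ s :: b) = graft (graft t (a ++ Leaf Sig :: b))
    (nseq (nleavess a) (Leaf Sig) ++ s :: nseq (nleavess b) (Leaf Sig)).
Proof.
rewrite !size_cat /= => st; rewrite graftA; last 2 first.
- by rewrite size_cat.
- by rewrite size_cat /= !size_nseq nleavess_cat nleavess_cons.
rewrite grafts_cat ?size_nseq // grafts_units -cat1s -[s :: nseq _ _]cat1s.
by rewrite cat1s grafts_cons // grafts_units graft_Leaf.
Qed.

(** A factorization of a node either has the leaf on top, with the whole term as its only factor, or
    keeps the root symbol and factorizes each child separately. *)
Lemma finite_graft_factorizations x :
  finite_pred (fun p : term Sig * seq (term Sig) =>
    size p.2 = nleaves p.1 /\ graft p.1 p.2 = x).
Proof.
elim/term_nested_ind: x => [|s xs IH].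
  exists [:: (Leaf Sig, [:: Leaf Sig])] => -[[|s cs] ts] /= [sts]; last by [].
  by case: ts sts => [|t []] // _; rewrite graft_Leaf => ->; left.
have [l lP] : finite_pred (fun p : seq (term Sig) * seq (term Sig) =>
    size p.2 = nleavess p.1 /\ grafts p.1 p.2 = xs).
  elim: xs IH => [|x xs IHxs] IH.
    exists [:: ([::], [::])] => -[[|c cs] ts] /= []; last by [].
    by case: ts => // _ _; left.
  have [|l lP] := finite_pred_prod (IH x (or_introl erefl)) (IHxs _).
    by move=> t txs; apply: IH; right.
  (* A factorization of the first child and one of the remaining children are merged by joining
     their lists of factors. *)
  exists (map (fun q => (q.1.1 :: q.2.1, q.1.2 ++ q.2.2)) l) => -[cs ts] /=.
  case: cs => [|c cs] []; first by [].
  rewrite nleavess_cons => /split_size[a [b [-> sa sb]]].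
  rewrite grafts_cons // => -[ga gb].
  apply/List.in_map_iff; exists ((c, a), (cs, b)); split=> //.
  by apply: lP.
exists ((Leaf Sig, [:: Node s xs]) :: map (fun q => (Node s q.1, q.2)) l).
move=> [[|s' cs] ts] /= [sts].
  by case: ts sts => [|t []] // _; rewrite graft_Leaf => ->; left.
rewrite graft_Node => -[-> gcs]; right.
by apply/List.in_map_iff; exists (cs, ts); split=> //; apply: lP.
Qed.

End Grafting.

(* Unlike [injection], stops at the heads, which may be constructors. *)
Lemma cons_inj (A : Type) (x y : A) (s s' : seq A) :
  x :: s = y :: s' -> x = y /\ s = s'.
Proof. by case. Qed.

(** * The free operad on well-formed terms *)

Section WellFormedTerms.
Variables (Sig : Type) (ar : Sig -> nat).
Implicit Types (t u : wterm ar) (ts us a b : seq (wterm ar)).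

Lemma wterm_inj t u : proj1_sig t = proj1_sig u -> t = u.
Proof.
case: t u => [t wt] [u wu] /= tu; subst u; congr exist.
exact: bool_irrelevance.
Qed.

Lemma map_wterm_inj ts us :
  map (@proj1_sig _ _) ts = map (@proj1_sig _ _) us -> ts = us.
Proof. by apply: inj_map => t u; apply: wterm_inj. Qed.

Lemma all_wfb ts : all (wfb ar) (map (@proj1_sig _ _) ts).
Proof. by elim: ts => //= t ts ->; rewrite (proj2_sig t). Qed.

Lemma val_wcomp t ts : size ts = warity t ->
  proj1_sig (wcomp t ts) = graft (proj1_sig t) (map (@proj1_sig _ _) ts).
Proof.
move=> sts; rewrite /wcomp.
have : wfb ar (graft (proj1_sig t) (map (@proj1_sig _ _) ts)).
  by apply: wfb_graft; rewrite ?size_map ?all_wfb // (proj2_sig t).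
set g := graft _ _ => wg.
(* The boolean is generalised together with its equation, on which the branches of [wcomp]
   depend. *)
suff H c (E : wfb ar g = c) : c ->
    proj1_sig (match c as c return wfb ar g = c -> wterm ar with
               | true => fun H => exist _ g H
               | false => fun=> t
               end E) = g by apply: H.
by case: c E.
Qed.

Lemma warity_wcomp t ts : size ts = warity t ->
  warity (wcomp t ts) = sumn (map (@warity _ ar) ts).
Proof.
move=> sts; rewrite /warity val_wcomp // nleaves_graft ?size_map //.
by rewrite /nleavess -map_comp.
Qed.

Lemma mkseq_insert (A : Type) (e s : A) (m n : nat) :
  mkseq (fun j => if j == m then s else e) (m + n.+1) = nseq m e ++ s :: nseq n e.
Proof.
apply: (@eq_from_nth _ e) => [|i].
  by rewrite size_mkseq size_cat /= !size_nseq.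
rewrite size_mkseq => im; rewrite nth_mkseq // nth_cat size_nseq.
have [lt_im|lt_mi|->] := ltngtP i m; last by rewrite subnn.
  by rewrite nth_nseq if_same.
rewrite -subn_gt0 in lt_mi; case: (i - m)%N lt_mi => [|k] //= _.
by rewrite nth_nseq if_same.
Qed.

Lemma wcomp_units t : wcomp t (nseq (warity t) (wunit ar)) = t.
Proof.
by apply: wterm_inj; rewrite val_wcomp ?size_nseq // map_nseq graft_units.
Qed.

(** The position of the partial composition is the number of leaves that the factors in [a] put
    before the place of [s]. *)
Lemma wcomp_insert t a s b : size (a ++ s :: b) = warity t ->
  wcomp t (a ++ s :: b) =
  wpcomp (wcomp t (a ++ wunit ar :: b)) (sumn (map (@warity _ ar) a)) s.
Proof.
move=> st; have st' : size (a ++ wunit ar :: b) = warity t.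
  by rewrite -st !size_cat.
rewrite /wpcomp warity_wcomp // map_cat sumn_cat /= add1n mkseq_insert.
apply: wterm_inj; rewrite !val_wcomp //; last first.
  by rewrite warity_wcomp // size_cat /= !size_nseq map_cat sumn_cat.
rewrite !map_cat /= !map_nseq.
rewrite graft_insert; last by rewrite size_cat /= !size_map -[RHS]st size_cat.
by rewrite /nleavess -!map_comp.
Qed.

Lemma finite_factorizations (x : wterm ar) :
  finite_pred (fun p : wterm ar * seq (wterm ar) =>
    size p.2 = warity p.1 /\ wcomp p.1 p.2 = x).
Proof.
apply: (finite_pred_inj
  (f := fun p => (proj1_sig p.1, map (@proj1_sig _ _) p.2))
  (finite_graft_factorizations (proj1_sig x))).
  by move=> [y ys] /= [sys <-]; rewrite size_map val_wcomp.
by move=> [y ys] [z zs] _ _ /= [/wterm_inj -> /map_wterm_inj ->].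
Qed.

Lemma wdeg_eq0 t : wdeg t = 0%N -> t = wunit ar.
Proof. by move=> dt; apply: wterm_inj; case: t dt => [[]]. Qed.

End WellFormedTerms.

(** * Supports of products and coproducts in a natural Hopf algebra *)

Section NaturalHopfAlgebra.
Variables (K : fieldType) (O : Type) (e : O) (arity : O -> nat).
Variable comp : O -> seq O -> O.

Lemma rd_reduced (w : seq O) : reduced e (rd e w).
Proof.
move=> y; rewrite -[rd e w]/(List.filter _ w) List.filter_In => -[_].
by case: excluded_middle_informative.
Qed.

Lemma reduced_cat (w w' : seq O) : reduced e (w ++ w') <-> reduced e w /\ reduced e w'.
Proof.
rewrite /reduced; split=> [red|[redt redd] y].
  by split=> y yw; apply: red; apply: List.in_or_app; [left|right].
by move=> yw; case: (List.in_app_or _ _ _ yw); [apply: redt|apply: redd].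
Qed.

Lemma reduced_take_drop (w : seq O) i :
  reduced e w <-> reduced e (take i w) /\ reduced e (drop i w).
Proof. by rewrite -reduced_cat cat_take_drop. Qed.

Lemma big_neq0 (I : Type) (s : seq I) (F : I -> K) :
  \sum_(i <- s) F i <> 0 -> exists i, F i <> 0.
Proof.
move=> nz; apply: NNPP => nex; apply: nz; rewrite big1 // => i _.
by apply: NNPP => Fi; apply: nex; exists i.
Qed.

Lemma mulr_neq0_and (x y : K) : x * y <> 0 -> x <> 0 /\ y <> 0.
Proof. by move=> xy; split=> E; apply: xy; rewrite E ?mul0r ?mulr0. Qed.

Lemma Nmul_neq0 (c c' : Nvec K O) w :
  Nmul c c' w <> 0 -> exists i, c (take i w) <> 0 /\ c' (drop i w) <> 0.
Proof. by move=> /big_neq0[i /mulr_neq0_and cc']; exists (val i). Qed.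

Lemma Tmul_neq0 (D D' : Ntens K O) u v :
  Tmul D D' u v <> 0 -> exists i j,
    D (take i u) (take j v) <> 0 /\ D' (drop i u) (drop j v) <> 0.
Proof.
by move=> /big_neq0[i /big_neq0[j /mulr_neq0_and DD']]; exists (val i), (val j).
Qed.

(** Every word in the support of the product is a concatenation of words from the two supports. *)
Lemma isN_Nmul (c c' : Nvec K O) : isN e c -> isN e c' -> isN e (Nmul c c').
Proof.
move=> [finc redc] [finc' redc']; split.
  apply: (finite_pred_surj (g := fun p => p.1 ++ p.2) (finite_pred_prod finc finc')).
  move=> w /Nmul_neq0[i cc']; exists (take i w, drop i w) => //=.
  by rewrite cat_take_drop.
move=> w /Nmul_neq0[i [/redc ct /redc' c'd]].
by apply/(reduced_take_drop w i).
Qed.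

Local Notation Dletter := (@Dletter K O e arity comp).
Local Notation Dword := (@Dword K O e arity comp).

Lemma Dletter_reduced x u v : Dletter x u v <> 0 -> reduced e u /\ reduced e v.
Proof. by move=> /fsum_neq0[p [_ _ <- <-] _]; split; apply: rd_reduced. Qed.

Lemma Dword_reduced w u v : Dword w u v <> 0 -> reduced e u /\ reduced e v.
Proof.
elim: w u v => [|x w IH] u v.
  by rewrite /= /Tone; case: u v => [|? ?] [|? ?] // _; split=> y [].
move=> /Tmul_neq0[i [j [/Dletter_reduced[ut vt] /IH[ud vd]]]].
by split; [apply/(reduced_take_drop u i)|apply/(reduced_take_drop v j)].
Qed.

Lemma Ncoprod_reduced (c : Nvec K O) u v :
  Ncoprod e arity comp c u v <> 0 -> reduced e u /\ reduced e v.
Proof.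
by move=> /fsum_neq0[w _ nz]; have [_ /Dword_reduced] := mulr_neq0_and nz.
Qed.

Hypothesis finite_fact : forall x, finite_pred (fun p : O * seq O =>
  size p.2 = arity p.1 /\ comp p.1 p.2 = x).

(** The support is covered by the reductions of the finitely many factorizations of [x]. *)
Lemma Dletter_finite x : finite_pred (fun p => Dletter x p.1 p.2 <> 0).
Proof.
apply: (finite_pred_surj (g := fun p => (rd e [:: p.1], rd e p.2)) (finite_fact x)).
by move=> [u v] /= /fsum_neq0[p [sp xE <- <-] _]; exists p.
Qed.

Lemma Dword_finite w : finite_pred (fun p => Dword w p.1 p.2 <> 0).
Proof.
elim: w => [|x w IH].
  by exists [:: ([::], [::])] => -[[|? ?] [|? ?]] //= _; left.
apply: (finite_pred_surj (g := fun q => (q.1.1 ++ q.2.1, q.1.2 ++ q.2.2))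
  (finite_pred_prod (Dletter_finite x) IH)).
move=> [u v] /= /Tmul_neq0[i [j DD]].
exists ((take i u, take j v), (drop i u, drop j v)) => //=.
by rewrite !cat_take_drop.
Qed.

Lemma Ncoprod_finite (c : Nvec K O) : finsupp c ->
  finite_pred (fun p => Ncoprod e arity comp c p.1 p.2 <> 0).
Proof.
move=> [s sP].
apply: finite_predS (finite_pred_union (s := s) (fun w _ => Dword_finite w)).
move=> [u v] /= /fsum_neq0[w cw cD]; exists w; first exact: sP.
by have [_] := mulr_neq0_and cD.
Qed.

End NaturalHopfAlgebra.

(** * The quotient operad and lifting along the projection *)

Section Quotient.
Variables (Sig : Type) (ar : Sig -> nat) (R : wterm ar -> wterm ar -> Prop).
Hypotheses (Hcong : operad_congruence R) (Hdeg : degree_compatible R).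
Hypothesis Hfin : finite_type R.
Implicit Types (t u : wterm ar) (ts us a b : seq (wterm ar)).
Local Notation pi := (@qproj _ ar R).

Let Rrefl t : R t t. Proof. by case: Hcong. Qed.
Let Rsym t u : R t u -> R u t.
Proof. by case: Hcong => _ [+ _]; apply. Qed.
Let Rtrans t u v : R t u -> R u v -> R t v.
Proof. by case: Hcong => _ [_ [+ _]]; apply. Qed.

Lemma warity_congr t u : R t u -> warity t = warity u.
Proof. by case: Hcong => _ [_ [_ [+ _]]]; apply. Qed.

Lemma qproj_eq t u : pi t = pi u <-> R t u.
Proof.
split=> [[]|tu]; first by move=> ->.
have tuE : R t = R u.
  apply: functional_extensionality => v; apply: propositional_extensionality.
  by split; apply: Rtrans => //; apply: Rsym.
by apply: eq_sig_hprop => //= C; apply: proof_irrelevance.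
Qed.

Lemma qrepK (C : qterm R) : pi (qrep C) = C.
Proof.
apply: eq_sig_hprop => /= [D|]; first exact: proof_irrelevance.
rewrite /qrep; case: constructive_indefinite_description => t /= tC.
by rewrite tC.
Qed.

Lemma map_qrepK (Cs : seq (qterm R)) : map pi (map (@qrep _ ar R) Cs) = Cs.
Proof. by elim: Cs => //= C Cs ->; rewrite qrepK. Qed.

Lemma qrep_qproj t : R (qrep (pi t)) t.
Proof. by apply/qproj_eq; rewrite qrepK. Qed.

Lemma qarity_qproj t : qarity (pi t) = warity t.
Proof. exact/warity_congr/qrep_qproj. Qed.

(** The factors are inserted one at a time into compositions with units, each insertion being a
    partial composition. *)
Lemma wcomp_congr_l t u ts : R t u -> size ts = warity t -> R (wcomp t ts) (wcomp u ts).
Proof.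
move=> tu sts; have atu := warity_congr tu.
(* The first [k] slots still hold units. As [b] shrinks [k] grows, until only units remain and both
   compositions are trivial. *)
suff H k b : (k + size b)%N = warity t ->
    R (wcomp t (nseq k (wunit ar) ++ b)) (wcomp u (nseq k (wunit ar) ++ b)).
  exact: (H 0%N).
elim: b k => [|s b IH] k.
  by rewrite addn0 cats0 => ->; rewrite {2}atu !wcomp_units.
rewrite /= addnS -addSn => skb.
have skb' : size (nseq k (wunit ar) ++ s :: b) = warity t.
  by rewrite size_cat size_nseq -skb /= addnS.
rewrite (wcomp_insert skb') (@wcomp_insert _ _ u) -?atu //.
have -> : nseq k (wunit ar) ++ wunit ar :: b = nseq k.+1 (wunit ar) ++ b.
  by rewrite -cat1s catA -(nseqD k 1) addn1.
case: Hcong => _ [_ [_ [_ [+ _]]]]; apply; first exact: IH.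
rewrite warity_wcomp ?size_cat ?size_nseq // map_cat sumn_cat !map_nseq.
by rewrite !sumn_nseq !mul1n addSn ltnS leq_addr.
Qed.

(** The factors are exchanged one at a time from the left, [a] being the prefix already treated. *)
Lemma wcomp_congr_r t ts us :
  map pi ts = map pi us -> size ts = warity t -> R (wcomp t ts) (wcomp t us).
Proof.
move=> tsus sts.
suff H a b b' : map pi b = map pi b' -> size (a ++ b) = warity t ->
    R (wcomp t (a ++ b)) (wcomp t (a ++ b')).
  exact: (H [::]).
elim: b b' a => [|s b IH] [|s' b'] //= a sbE st; have [ss' bb'] := cons_inj sbE.
have sb : size b = size b' by rewrite -(size_map pi) bb' size_map.
have st' : size (a ++ s' :: b) = warity t by rewrite -st !size_cat.
apply: (@Rtrans _ (wcomp t (a ++ s' :: b))).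
  rewrite (wcomp_insert st) (wcomp_insert st').
  case: Hcong => _ [_ [_ [_ [_]]]]; apply; first exact/qproj_eq.
  rewrite warity_wcomp; last by rewrite -st !size_cat.
  by rewrite map_cat sumn_cat /= -addn1 leq_add2l.
by rewrite -!cat_rcons; apply: IH; rewrite // cat_rcons.
Qed.

(** The projection is an operad morphism: composing the chosen representatives instead of [t] and
    [ts] stays in the same class. *)
Lemma qcomp_qproj t ts : size ts = warity t ->
  qcomp (pi t) (map pi ts) = pi (wcomp t ts).
Proof.
move=> sts; apply/qproj_eq.
have at_ := warity_congr (qrep_qproj t).
apply: (@Rtrans _ (wcomp t (map (@qrep _ ar R) (map pi ts)))).
  by apply: wcomp_congr_l; rewrite ?size_map ?at_ //; apply: qrep_qproj.
by apply: wcomp_congr_r; rewrite ?map_qrepK ?size_map.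
Qed.

Lemma qproj_eq_unit t : pi t = qunit R <-> t = wunit ar.
Proof. by split=> [/qproj_eq/Hdeg/wdeg_eq0|->]. Qed.

Lemma reduced_qproj ts : reduced (qunit R) (map pi ts) <-> reduced (wunit ar) ts.
Proof.
split=> red y.
  by move=> yts /qproj_eq_unit; apply: red; apply: List.in_map.
by move=> /List.in_map_iff[t [<- tts]] /qproj_eq_unit; apply: red.
Qed.

Lemma rd_qproj ts : rd (qunit R) (map pi ts) = map pi (rd (wunit ar) ts).
Proof.
elim: ts => //= t ts ->.
case: excluded_middle_informative => [tu|tn];
  case: excluded_middle_informative => // tu'.
  by case: tu'; apply/qproj_eq_unit.
by case: tn; apply/qproj_eq_unit.
Qed.

(* A unit letter has only the unit as a lift, so a lift of a word is         *)
(* determined by the lift of its reduction.                                  *)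
Lemma qproj_rd_inj ts us :
  map pi ts = map pi us -> rd (wunit ar) ts = rd (wunit ar) us -> ts = us.
Proof.
elim: ts us => [|t ts IH] [|u us] //= tE; have [tu tsus] := cons_inj tE.
case: excluded_middle_informative => [Et|Nt].
  have -> : u = wunit ar by apply/qproj_eq_unit; rewrite -tu; apply/qproj_eq_unit.
  by case: excluded_middle_informative => // _ /(IH _ tsus) ->; rewrite Et.
case: excluded_middle_informative => [Eu|Nu].
  by case: Nt; apply/qproj_eq_unit; rewrite tu; apply/qproj_eq_unit.
by move=> [-> /(IH _ tsus) ->].
Qed.

(** Unit letters are lifted to the leaf, the others to the successive letters of [v]. As [v] is
    reduced, none of these is deleted again. *)
Lemma lift_rd (Cs : seq (qterm R)) v :
  reduced (wunit ar) v -> rd (qunit R) Cs = map pi v ->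
  exists2 ts, map pi ts = Cs & rd (wunit ar) ts = v.
Proof.
elim: Cs v => [|C Cs IH] v vred /=; first by case: v {vred} => // _; exists [::].
case: excluded_middle_informative => [CE|NC] /=.
  move=> /(IH _ vred)[ts <- rts]; exists (wunit ar :: ts); rewrite /= ?CE //.
  by case: excluded_middle_informative.
case: v vred => // t v vred CE; have [-> rv] := cons_inj CE.
have [|ts <- rts] := IH v _ rv; first by move=> y yv; apply: vred; right.
exists (t :: ts) => //=; case: excluded_middle_informative => [tu|Nt] /=.
  by case: (vred t) => //; left.
by rewrite rts.
Qed.

Lemma finite_class (X : qterm R) : finite_pred (fun t => pi t = X).
Proof.
have [l lP] := Hfin (qrep X).
by exists l => t; rewrite -(qrepK X) => /qproj_eq/Rsym/lP.
Qed.

Lemma finite_lifts (x : seq (qterm R)) : finite_pred (fun f => map pi f = x).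
Proof.
elim: x => [|X x IH]; first by exists [:: [::]] => -[|//] _; left.
apply: (finite_pred_surj (g := fun p => p.1 :: p.2)
  (finite_pred_prod (finite_class X) IH)).
by move=> [|t f] //= tfE; have [tX fx] := cons_inj tfE; exists (t, f).
Qed.

(** * Coproduct coefficients of the quotient as sums over lifts *)

Section Coproduct.
Variable K : fieldType.
Local Notation DletterT := (@Dletter K _ (wunit ar) (@warity _ ar) (@wcomp _ ar)).
Local Notation DletterQ := (@Dletter K _ (qunit R) (@qarity _ ar R) (@qcomp _ ar R)).
Local Notation DwordT := (@Dword K _ (wunit ar) (@warity _ ar) (@wcomp _ ar)).
Local Notation DwordQ := (@Dword K _ (qunit R) (@qarity _ ar R) (@qcomp _ ar R)).

Lemma Dletter_lift (X : qterm R) (u v : seq (wterm ar)) :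
  reduced (wunit ar) u -> reduced (wunit ar) v ->
  DletterQ X (map pi u) (map pi v) = fsum (fun t => pi t = X) (fun t => DletterT t u v).
Proof.
move=> ured vred.
pose P (p : wterm ar * seq (wterm ar)) :=
  [/\ size p.2 = warity p.1, pi (wcomp p.1 p.2) = X,
      rd (wunit ar) [:: p.1] = u & rd (wunit ar) p.2 = v].
have finP : finite_pred P.
  apply: (finite_pred_fiber (f := fun p => wcomp p.1 p.2) (finite_class X)).
    by move=> p [].
  move=> t _; apply: finite_predS (finite_factorizations t).
  by move=> p [[]].
(* Lifted factorizations are counted in two ways: grouped by the term they compose to, or projected
   bijectively onto the factorizations of [X]. *)
transitivity (fsum P (fun=> 1 : K)); last first.
  rewrite (@fsum_fiber _ _ _ (fun p => wcomp p.1 p.2) _ (fun t => pi t = X)) //.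
  - apply: eq_fsum => // t tX; apply: eq_fsum => // p.
    by split=> [[[? ? ? ?] <-]|[? tE ? ?]] //; split=> //; split=> //; rewrite -tE.
  - exact: finite_class.
  - by move=> p [].
rewrite /Dletter (@fsum_bij _ _ _ (fun p => (pi p.1, map pi p.2)) P) //.
- move=> [y ys] [/= sys yX yu yv]; split=> /=.
  + by rewrite size_map qarity_qproj.
  + by rewrite qcomp_qproj.
  + exact: etrans (rd_qproj [:: y]) (congr1 (map pi) yu).
  + by rewrite rd_qproj yv.
- move=> [y ys] [z zs] [/= _ _ yu yv] [/= _ _ zu zv] E.
  have [E1 E2] : pi y = pi z /\ map pi ys = map pi zs.
    by split; [exact: (congr1 fst E)|exact: (congr1 snd E)].
  (* The roots are compared as one-letter words, so that [qproj_rd_inj] covers them too. *)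
  have [-> _] : y = z /\ [::] = [::] :> seq (wterm ar).
    by apply: cons_inj; apply: qproj_rd_inj; rewrite /= ?E1 // yu zu.
  by rewrite (qproj_rd_inj E2) // yv zv.
move=> [C Cs] [/= sCs XE Cu Cv].
have [ts tsC tsu] := lift_rd (Cs := [:: C]) ured Cu.
have [us usC usv] := lift_rd vred Cv.
case: ts tsC tsu => [|t []] //= tE tu.
have [tC _] := cons_inj tE.
have sus : size us = warity t.
  by rewrite -qarity_qproj tC -sCs -usC size_map.
exists (t, us); last by rewrite /= tC usC.
by split; rewrite //= -qcomp_qproj // tC usC.
Qed.

Lemma Dword_lift (x : seq (qterm R)) (u v : seq (wterm ar)) :
  reduced (wunit ar) u -> reduced (wunit ar) v ->
  DwordQ x (map pi u) (map pi v) = fsum (fun f => map pi f = x) (fun f => DwordT f u v).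
Proof.
elim: x u v => [|X x IH] u v ured vred.
  rewrite (@fsum_enumerates _ _ _ [:: [::]]) ?big_seq1 /= /Tone ?/nilp ?size_map //.
  split; first by apply: List.NoDup_cons => //; apply: List.NoDup_nil.
  by move=> [|t f]; split=> //=; [left|case].
(* Lifts are grouped by first letter; a lift of [X :: x] is nonempty, so the default of [head] is
   never reached. *)
rewrite (@fsum_fiber _ _ _ (head (wunit ar)) _ (fun t => pi t = X)); first last.
- by move=> [|t f] //= tE; have [] := cons_inj tE.
- exact: finite_class.
- exact: finite_lifts.
transitivity (fsum (fun t => pi t = X) (fun t =>
    fsum (fun f => map pi f = x) (fun f => DwordT (t :: f) u v))); last first.
  apply: eq_fsum => // t tX; symmetry; apply: fsum_bij.
  - exact: finite_lifts.
  - by move=> f /= ->; rewrite tX.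
  - by move=> f f' _ _ fE; have [] := cons_inj fE.
  - move=> [|t' f] [] //= fE tt'; have [_ fx] := cons_inj fE.
    by exists f => //; rewrite tt'.
(* The sums over the cuts [i] and [j] are moved outside. For fixed cuts, the head and the tail are
   lifted independently and the double sum factors. *)
rewrite /= /Tmul !size_map !fsumE; under [RHS]eq_bigr do rewrite fsumE.
under [RHS]eq_bigr do rewrite exchange_big.
rewrite [RHS]exchange_big /=; apply: eq_bigr => i _.
under [RHS]eq_bigr do rewrite exchange_big.
rewrite [RHS]exchange_big /=; apply: eq_bigr => j _.
have /(reduced_take_drop _ _ i)[utred udred] := ured.
have /(reduced_take_drop _ _ j)[vtred vdred] := vred.
rewrite -!map_take -!map_drop Dletter_lift // IH // !fsumE mulr_suml.
by apply: eq_bigr => t _; rewrite mulr_sumr.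
Qed.

(** * The map [phi] as composition with the projection *)

Lemma phiE_neq0 (x : seq (qterm R)) f : phiE K x f <> 0 -> map pi f = x.
Proof. by rewrite /phiE /iverson; case: excluded_middle_informative => // -[]. Qed.

Lemma phiE_qproj f : reduced (wunit ar) f -> phiE K (map pi f) f = 1.
Proof. by move=> fred; rewrite /phiE iversonT. Qed.

Lemma phiE_not_reduced (x : seq (qterm R)) f : ~ reduced (wunit ar) f -> phiE K x f = 0.
Proof. by move=> nred; rewrite /phiE iversonF // => -[]. Qed.

Lemma phiE_eq0 (x : seq (qterm R)) f : x <> map pi f -> phiE K x f = 0.
Proof. by move=> xf; apply: NNPP => /phiE_neq0 fx; apply: xf. Qed.

(** Only the word [map pi f] can contribute. If [f] is not reduced, neither is this word, and [c]
    vanishes there. *)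
Lemma phi_qproj (c : Nvec K (qterm R)) f : isN (qunit R) c -> phi c f = c (map pi f).
Proof.
move=> [finc redc]; rewrite /phi (@fsum_single _ _ _ _ (map pi f)) //.
- have [fred|nred] := excluded_middle_informative (reduced (wunit ar) f).
    by rewrite phiE_qproj ?mulr1.
  rewrite phiE_not_reduced // mulr0; symmetry; apply: NNPP => /redc.
  by rewrite reduced_qproj.
- by move=> x /NNPP ->; rewrite mul0r.
- by move=> x xf; rewrite phiE_eq0 ?mulr0.
Qed.

Lemma phi2_qproj (D : Ntens K (qterm R)) f1 f2 :
  finite_pred (fun p => D p.1 p.2 <> 0) ->
  reduced (wunit ar) f1 -> reduced (wunit ar) f2 ->
  phi2 D f1 f2 = D (map pi f1) (map pi f2).
Proof.
move=> finD red1 red2; rewrite /phi2 (@fsum_single _ _ _ _ (map pi f1, map pi f2)) //=.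
- by rewrite !phiE_qproj // !mulr1.
- by move=> p /NNPP ->; rewrite !mul0r.
- move=> [x1 x2] /= xf.
  have [x1f|x1f] := excluded_middle_informative (x1 = map pi f1); last first.
    by rewrite (phiE_eq0 x1f) mulr0 mul0r.
  rewrite [phiE K x2 f2]phiE_eq0 ?mulr0 // => x2f; apply: xf.
  by rewrite x1f x2f.
Qed.

Lemma phi2_reduced (D : Ntens K (qterm R)) f1 f2 :
  phi2 D f1 f2 <> 0 -> reduced (wunit ar) f1 /\ reduced (wunit ar) f2.
Proof.
move=> /fsum_neq0[p _ nz]; have [/mulr_neq0_and[_ nz1] nz2] := mulr_neq0_and nz.
by split; apply: NNPP => /phiE_not_reduced H; [apply: nz1|apply: nz2].
Qed.

(** The support of [phi c] lies over that of [c], and each word has finitely many lifts. *)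
Lemma isN_phi (c : Nvec K (qterm R)) : isN (qunit R) c -> isN (wunit ar) (phi c).
Proof.
move=> cN; have [finc redc] := cN; split.
  apply: (finite_pred_fiber (f := map pi) finc).
    by move=> f; rewrite phi_qproj.
  by move=> x _; apply: finite_predS (finite_lifts x) => f [].
by move=> f; rewrite phi_qproj // => /redc/reduced_qproj.
Qed.

Local Notation DeltaT := (@Ncoprod K _ (wunit ar) (@warity _ ar) (@wcomp _ ar)).
Local Notation DeltaQ := (@Ncoprod K _ (qunit R) (@qarity _ ar R) (@qcomp _ ar R)).

(** The support of [phi c] is grouped by projection. Over [x], [phi c] is the constant [c x], and
    [Dword_lift] sums the rest. *)
Lemma Ncoprod_phi (c : Nvec K (qterm R)) f1 f2 :
  isN (qunit R) c -> reduced (wunit ar) f1 -> reduced (wunit ar) f2 ->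
  DeltaT (phi c) f1 f2 = DeltaQ c (map pi f1) (map pi f2).
Proof.
move=> cN red1 red2; have [finc redc] := cN.
rewrite /Ncoprod (@fsum_fiber _ _ _ (map pi) _ (fun x => c x <> 0)) //; first last.
- by move=> f; rewrite phi_qproj.
- by have [] := isN_phi cN.
apply: eq_fsum => // x cx; rewrite Dword_lift // -fsum_distrr; apply: eq_fsum.
  by move=> f; rewrite phi_qproj //; split=> [[]|fx] //; rewrite fx.
by move=> f [_ fx]; rewrite phi_qproj // fx.
Qed.

(* Both words of a support point lift to reduced forests, so the support is  *)
(* the image of that of the coproduct computed in the free operad.           *)
Lemma Ncoprod_quotient_finite (c : Nvec K (qterm R)) : isN (qunit R) c ->
  finite_pred (fun p => DeltaQ c p.1 p.2 <> 0).
Proof.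
move=> cN; have [finc _] := isN_phi cN.
apply: (finite_pred_surj (g := fun p => (map pi p.1, map pi p.2))
  (Ncoprod_finite (wunit ar) (@finite_factorizations _ ar) finc)).
move=> [x y] /= nz; have [xred yred] := Ncoprod_reduced nz.
exists (map (@qrep _ ar R) x, map (@qrep _ ar R) y); last by rewrite /= !map_qrepK.
by rewrite /= Ncoprod_phi ?map_qrepK //; apply/reduced_qproj; rewrite map_qrepK.
Qed.

End Coproduct.

End Quotient.

Theorem theorem3p5 (K : fieldType) (HK : [pchar K] =i pred0)
  (Sig : Type) (ar : Sig -> nat) (R : wterm ar -> wterm ar -> Prop)
  (Hcong : operad_congruence R) (Hdeg : degree_compatible R)
  (Hfin : finite_type R) :
  (* well-defined: each phi(E_x) is a finite sum, so phi maps N(T/R) into N(T) *)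
  (forall x : seq (qterm R), reduced (qunit R) x -> finsupp (phiE K x)) /\
  (forall c : Nvec K (qterm R), isN (qunit R) c -> isN (wunit ar) (phi c)) /\
  (* injective *)
  (forall c1 c2 : Nvec K (qterm R), isN (qunit R) c1 -> isN (qunit R) c2 ->
     phi c1 = phi c2 -> c1 = c2) /\
  (* algebra morphism *)
  phi (@Nunit K (qterm R)) = @Nunit K (wterm ar) /\
  (forall c1 c2 : Nvec K (qterm R), isN (qunit R) c1 -> isN (qunit R) c2 ->
     phi (Nmul c1 c2) = Nmul (phi c1) (phi c2)) /\
  (* coalgebra morphism *)
  (forall c : Nvec K (qterm R), isN (qunit R) c ->
     Ncoprod (wunit ar) (@warity _ ar) (@wcomp _ ar) (phi c)
     = phi2 (Ncoprod (qunit R) (@qarity _ ar R) (@qcomp _ ar R) c)) /\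
  (forall c : Nvec K (qterm R), isN (qunit R) c -> Ncounit (phi c) = Ncounit c).
Proof.
have phiP c : isN (qunit R) c -> phi c = fun f => c (map (@qproj _ ar R) f).
  by move=> cN; apply: functional_extensionality => f; rewrite phi_qproj.
split.
  move=> x _; apply: finite_predS (finite_lifts Hcong Hfin x) => f.
  exact: phiE_neq0.
split; first exact: isN_phi.
split.
  move=> c1 c2 c1N c2N; rewrite !phiP // => c12.
  apply: functional_extensionality => x.
  (* The word of representatives lifts [x], so evaluating there recovers the coefficients at [x]. *)
  by have := congr1 (fun c => c (map (@qrep _ ar R) x)) c12; rewrite !map_qrepK.
split.
  (* [phiP] asks that the unit satisfy [isN]: its support is the empty word, which is reduced. *)
  rewrite phiP; last first.
    split; first by exists [:: [::]] => -[|? ?] //= _; left.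
    by move=> [|? ?] // _ y [].
  by apply: functional_extensionality => -[].
split.
  move=> c1 c2 c1N c2N; rewrite !phiP //; last exact: isN_Nmul.
  apply: functional_extensionality => f; rewrite /Nmul size_map.
  by apply: eq_bigr => i _; rewrite map_take map_drop.
split; last by move=> c cN; rewrite phiP.
move=> c cN.
apply: functional_extensionality => f1; apply: functional_extensionality => f2.
(* On reduced pairs both sides are the coefficient at the projected pair; on all others both
   vanish. *)
have [[red1 red2]|nred] := excluded_middle_informative
  (reduced (wunit ar) f1 /\ reduced (wunit ar) f2).
  by rewrite phi2_qproj ?Ncoprod_phi //; apply: Ncoprod_quotient_finite.
transitivity (0 : K).
  by apply: NNPP => nz; apply: nred; apply: Ncoprod_reduced nz.
by symmetry; apply: NNPP => nz; apply: nred; apply: phi2_reduced nz.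
Qed.
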